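(* Let $d$ be a prime, let $N>1$ be an integer, let $S$ be a spread of the symplectic polar space $\mathcal{W}_{2N-1}(d)$, and let $\gamma^{-1}(S)$ be the associated MCC of size $d^N+1$ consisting of generalized Pauli operators of $\mathbb{C}^{d^N}$. Put $\mathcal{B}_S:=\beta(\gamma^{-1}(S))$, a maximal MUB of size $d^N+1$ in $\mathbb{C}^{d^N}$. Then $\gamma^{-1}(S)$ and $\alpha(\mathcal{B}_S)$ are both elements of $\beta^{-1}(\mathcal{B}_S)$, but they are not isomorphic as MCCs. In particular, $\beta$ is not injective, and nonisomorphic MCCs can have the same image under $\beta$.
   Context: MUBs. Two orthonormal bases $\mathcal{B},\mathcal{B}'$ of $\mathbb{C}^D$ are mutually unbiased if $|\langle\phi|\psi\rangle|^2=1/D$ for all $|\phi\rangle\in\mathcal{B}$, $|\psi\rangle\in\mathcal{B}'$. A maximal MUB in $\mathbb{C}^D$ is a set of $D+1$ pairwise mutually unbiased orthonormal bases of $\mathbb{C}^D$; basis vectors are considered up to multiplication by scalars of modulus $1$. MCCs. Operators $A,B$ on $\mathbb{C}^D$ are orthogonal if $\mathrm{tr}(AB^\dagger)=0$. Let $\mathcal{V}$ be a set of $D^2$ mutually orthogonal unitary operators on $\mathbb{C}^D$ containing the identity $\mathrm{id}$. An MCC (of size $D+1$) is a set $\mathcal{U}=\{\mathcal{U}_0,\dots,\mathcal{U}_D\}$ of $D+1$ pairwise disjoint subsets of $\mathcal{V}\setminus\{\mathrm{id}\}$ (for some such $\mathcal{V}$), each of size $D-1$, such that the elements of each $\mathcal{U}_i$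 commute with each other. The set of operators of $\mathcal{U}$ is $\Omega=\bigcup_i\mathcal{U}_i$, and $A(\mathcal{U})$ is the subgroup of the unitary group $\mathbf{U}_D(\mathbb{C})$ generated by $\Omega$. The map $\beta$. For an MCC $\mathcal{U}$, $\beta(\mathcal{U})$ is the set of the $D+1$ common eigenbases (orthonormal, unique up to scalars) of the classes $\mathcal{U}_0,\dots,\mathcal{U}_D$; it is known that this is a maximal MUB. $\beta^{-1}(\mathcal{B})$ denotes the set of MCCs $\mathcal{U}$ with $\beta(\mathcal{U})=\mathcal{B}$. The map $\alpha$. Let $\mathcal{B}=\{\mathcal{B}_0,\dots,\mathcal{B}_D\}$ be a maximal MUB in $\mathbb{C}^D$, with each basis written (with a fixed ordering) as $\mathcal{B}_k=\{|\psi^k_1\rangle,\dots,|\psi^k_D\rangle\}$. For $k=0,\dots,D$ and $j=1,\dots,D-1$ put $U^k_j=\sum_{r=1}^{D}e^{2\pi i jr/D}|\psi^k_r\rangle\langle\psi^k_r|$. Then $\alpha(\mathcal{B})$ is the MCC $\{\mathcal{U}_0,\dots,\mathcal{U}_D\}$ with $\mathcal{U}_k=\{U^k_j : j=1,\dots,D-1\}$. Isomorphism of MCCs. Scaling an MCC means replacing each of its operators by a multiple of it by a complex scalar of modulus $1$ (the scalars may depend on the operator). MCCs $\mathcal{U},\mathcal{U}'$ with operator sets $\Omega,\Omega'$ are isomorphic if, after possibly scaling, there is a group isomorphism $A(\mathcal{U})\to A(\mathcal{U}')$ which maps $\Omega$ onto $\Omega'$. Pauli operators. Let $d$ be a prime,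 $\omega=e^{2\pi i/d}$, and let $\{|s\rangle: s=0,\dots,d-1\}$ be the standard basis of $\mathbb{C}^d$. Let $X_d|s\rangle=|s+1 \bmod d\rangle$ and $Z_d|s\rangle=\omega^s|s\rangle$. The generalized Pauli operators of $\mathbb{C}^{d^N}$ are the $d^{2N}$ operators $\sigma=(X_d^{a_1}Z_d^{b_1})\otimes\cdots\otimes(X_d^{a_N}Z_d^{b_N})$ with $a_i,b_i\in\{0,\dots,d-1\}$; $\mathbb{P}$ is the set of these and $\mathbb{P}^\times=\mathbb{P}\setminus\{\mathrm{id}\}$. Symplectic polar space. $\mathcal{W}_{2N-1}(d)$ consists of the points of the projective space $\mathbf{PG}(2N-1,d)$ over $\mathbb{F}_d$ together with all subspaces that are totally isotropic for the form $(X_0Y_1-X_1Y_0)+\cdots+(X_{2N-2}Y_{2N-1}-X_{2N-1}Y_{2N-2})$. A spread of $\mathcal{W}_{2N-1}(d)$ is a partition of its point set into totally isotropic subspaces of projective dimension $N-1$; spreads are known to exist for all such $d,N$. The map $\gamma:\mathbb{P}^\times\to\{\text{points of }\mathcal{W}_{2N-1}(d)\}$ sends the operator $\sigma$ above to the point spanned by $(a_1,b_1,\dots,a_N,b_N)$; two operators commute if and only if their images span a totally isotropic subspace. For a spread $S$, $\gamma^{-1}(S)$ is the MCC in $\mathbb{C}^{d^N}$ (so $D=d^N$) whose classes are the $d^N+1$ sets $\{\sigma\in\mathbb{P}^\times:\gamma(\sigma)\in W\}$, $W\in S$. *)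

(* Defs.v *)
From HB Require Import structures.
From mathcomp Require Import all_boot all_order all_algebra.
From mathcomp Require Import complex mxtens.
From mathcomp Require Import all_classical all_reals all_analysis.

Set Implicit Arguments.
Unset Strict Implicit.
Unset Printing Implicit Defensive.

Import Order.TTheory GRing.Theory Num.Theory.

Local Open Scope classical_set_scope.
Local Open Scope card_scope.
Local Open Scope ring_scope.
Local Open Scope complex_scope.
Local Open Scope sesquilinear_scope.

Section Hilbert.
Variable R : realType.
Local Notation C := R[i].

(* e^(i x) for real x *)
Definition expi (x : R) : C := cos x +i* sin x.

Variable D : nat.

Definition braket (phi psi : 'cV[C]_D) : C := (phi^t* *m psi) ord0 ord0.

Definition orthonormal_basis (b : 'I_D -> 'cV[C]_D) : Prop :=
  forall r s, braket (b r) (b s) = (r == s)%:R.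

(* Bases are considered up to reordering and up to multiplying their vectors
   by scalars of modulus 1: a vector is replaced by the set of its unimodular
   multiples, and a basis by the set of the D classes so obtained.  Equality of
   bases, and of sets of bases, is then plain equality. *)
Definition phase_class (v : 'cV[C]_D) : set 'cV[C]_D :=
  [set w | exists2 c : C, `|c| = 1 & w = c *: v].

Definition basis_class (b : 'I_D -> 'cV[C]_D) : set (set 'cV[C]_D) :=
  [set phase_class (b r) | r in [set: 'I_D]].

Definition unbiased (X Y : set (set 'cV[C]_D)) : Prop :=
  forall x y, X x -> Y y -> forall phi psi, x phi -> y psi ->
    `|braket phi psi| ^+ 2 = D%:R^-1.

Definition is_maxMUB (B : set (set (set 'cV[C]_D))) : Prop :=
  [/\ B #= `I_D.+1,
      forall X, B X -> exists2 b, orthonormal_basis b & X = basis_class b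
    & forall X Y, B X -> B Y -> X <> Y -> unbiased X Y].

Definition op_orthogonal (A B : 'M[C]_D) : Prop := \tr (A *m B^t*) = 0.

Definition is_MCC (U : set (set 'M[C]_D)) : Prop :=
  exists V : set 'M[C]_D,
    [/\ [/\ V #= `I_(D ^ 2),
            V `<=` [set A | A \is unitarymx],
            forall A B, V A -> V B -> A <> B -> op_orthogonal A B
          & V 1%:M],
        U #= `I_D.+1,
        forall K, U K ->
          [/\ K `<=` V `\ 1%:M, K #= `I_D.-1
            & forall A B, K A -> K B -> comm_mx A B]
      & forall K L, U K -> U L -> K <> L -> K `&` L = set0].

Definition is_common_eigenbasis (K : set 'M[C]_D) (b : 'I_D -> 'cV[C]_D) :
    Prop :=
  orthonormal_basis b /\
  forall A, K A -> forall r, exists lambda : C, A *m b r = lambda *: b r.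

Definition beta (U : set (set 'M[C]_D)) : set (set (set 'cV[C]_D)) :=
  [set X | exists K b,
     [/\ U K, is_common_eigenbasis K b & X = basis_class b]].

Definition beta_preimage (B : set (set (set 'cV[C]_D))) :
    set (set (set 'M[C]_D)) :=
  [set U | is_MCC U /\ beta U = B].

(* A choice of the data used to define alpha: an indexing of the bases, an
   ordering of each of them and a representative of each basis vector. *)
Definition is_listing (B : set (set (set 'cV[C]_D)))
    (psi : 'I_D.+1 -> 'I_D -> 'cV[C]_D) : Prop :=
  (forall k, orthonormal_basis (psi k)) /\
  set_bij setT B (fun k => basis_class (psi k)).

(* The basis vectors are indexed by r = 0, ..., D - 1 instead of 1, ..., D,
   hence the r.+1 in the exponent. *)
Definition alpha_op (psi : 'I_D.+1 -> 'I_D -> 'cV[C]_D) (k : 'I_D.+1)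
    (j : nat) : 'M[C]_D :=
  \sum_(r < D) expi (2 * pi * (j * r.+1)%N%:R / D%:R)
                 *: (psi k r *m (psi k r)^t*).

Definition alpha (psi : 'I_D.+1 -> 'I_D -> 'cV[C]_D) : set (set 'M[C]_D) :=
  [set [set alpha_op psi k j | j in [set j : nat | (0 < j < D)%N]]
  | k in [set: 'I_D.+1]].

Definition operators (U : set (set 'M[C]_D)) : set 'M[C]_D :=
  \bigcup_(K in U) K.

Definition is_unitary_subgroup (G : set 'M[C]_D) : Prop :=
  [/\ G `<=` [set A | A \is unitarymx], G 1%:M,
      forall A B, G A -> G B -> G (A *m B)
    & forall A, G A -> G (invmx A)].

Definition MCC_group (U : set (set 'M[C]_D)) : set 'M[C]_D :=
  smallest is_unitary_subgroup (operators U).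

Definition scale_MCC (c : 'M[C]_D -> C) (U : set (set 'M[C]_D)) :
    set (set 'M[C]_D) :=
  [set [set c A *: A | A in K] | K in U].

End Hilbert.

Definition MCC_isomorphic (R : realType) (D D' : nat)
    (U : set (set 'M[R[i]]_D)) (U' : set (set 'M[R[i]]_D')) : Prop :=
  exists (c : 'M[R[i]]_D -> R[i]) (c' : 'M[R[i]]_D' -> R[i]),
    [/\ forall A, `|c A| = 1, forall A, `|c' A| = 1
      & exists f : 'M[R[i]]_D -> 'M[R[i]]_D',
          let V := scale_MCC c U in
          let V' := scale_MCC c' U' in
          [/\ set_bij (MCC_group V) (MCC_group V') f,
              forall A B, MCC_group V A -> MCC_group V B ->
                f (A *m B) = f A *m f B
            & f @` operators V = operators V']].

Section Pauli.
Variables (R : realType) (d : nat).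
Local Notation C := R[i].

(* Operators act on column vectors, so |s> |-> |s + 1 mod d> puts the 1 of
   column s in row s + 1 mod d. *)
Definition pauliX : 'M[C]_d :=
  \matrix_(r, s) (r == (s.+1 %% d)%N :> nat)%:R.

Definition pauliZ : 'M[C]_d :=
  \matrix_(r, s) ((r == s)%:R * expi (2 * pi / d%:R) ^+ s).

Fixpoint tensor (N : nat) : ('I_N -> 'M[C]_d) -> 'M[C]_(d ^ N) :=
  match N return ('I_N -> 'M[C]_d) -> 'M[C]_(d ^ N) with
  | 0 => fun=> 1%:M
  | N'.+1 => fun A =>
      castmx (esym (expnS d N'), esym (expnS d N'))
             (tensmx (A ord0) (tensor (fun i => A (lift ord0 i))))
  end.

Variable N : nat.

Definition pauli (a b : 'I_N -> 'I_d) : 'M[C]_(d ^ N) :=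
  tensor (fun i => pauliX ^+ a i *m pauliZ ^+ b i).

(* The vector (a_1, b_1, ..., a_N, b_N): mxvec lists the entries of an
   N x 2 matrix row by row. *)
Definition pauli_vec (a b : 'I_N -> 'I_d) : 'rV['F_d]_(N * 2) :=
  mxvec (\matrix_(i < N, j < 2) (if j == ord0 then a i else b i)%:R).

(* The form sum_i (X_(2i) Y_(2i+1) - X_(2i+1) Y_(2i)); mxvec_index i j is the
   position 2 i + j. *)
Definition symplectic_form (x y : 'rV['F_d]_(N * 2)) : 'F_d :=
  let X (i : 'I_N) (j : 'I_2) := x ord0 (mxvec_index i j) in
  let Y (i : 'I_N) (j : 'I_2) := y ord0 (mxvec_index i j) in
  \sum_(i < N) (X i ord0 * Y i ord_max - X i ord_max * Y i ord0).

Definition totally_isotropic (W : {vspace 'rV['F_d]_(N * 2)}) : Prop :=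
  {in W &, forall x y, symplectic_form x y = 0}.

(* Projective dimension N - 1 is linear dimension N, and points are the
   subspaces of linear dimension 1. *)
Definition is_spread (S : set {vspace 'rV['F_d]_(N * 2)}) : Prop :=
  (forall W, S W -> totally_isotropic W /\ \dim W = N) /\
  (forall P : {vspace 'rV['F_d]_(N * 2)}, \dim P = 1%N ->
     exists! W, S W /\ (P <= W)%VS).

Definition pauli_class (W : {vspace 'rV['F_d]_(N * 2)}) :
    set 'M[C]_(d ^ N) :=
  [set sigma | sigma <> 1%:M /\
     exists a b, sigma = pauli a b /\ (<[pauli_vec a b]> <= W)%VS].

(* gamma^-1(S) *)
Definition pauli_MCC (S : set {vspace 'rV['F_d]_(N * 2)}) :
    set (set 'M[C]_(d ^ N)) :=
  [set pauli_class W | W in S].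

End Pauli.

Arguments pauli_MCC R {d N} S.

(* Main.v *)
Require Import Defs.
From HB Require Import structures.
From mathcomp Require Import all_boot all_order all_algebra all_field.
From mathcomp Require Import complex mxtens.
From mathcomp Require Import all_classical all_reals all_analysis.
From mathcomp Require Import ring lra zify.

(** The operators of a class of an MCC together with the identity are [D]
    orthogonal unitaries which are simultaneously diagonal in the eigenbasis, so
    their span contains the rank one projectors of that basis.  Hence the
    eigenbasis is unique up to phases, and for two different classes the trace
    of a product of two projectors reduces to the term of the identity, [1 / D]:
    the eigenbases form a maximal MUB.

    If two operators of [gamma^-1(S)] are [A] and [B], then [A B] is [B A] up to
    a [d]-th root of unity, so [A ^+ d] commutes with [B], even after scaling.
    An isomorphism onto [alpha(B_S)] would make the [d]-th power of [U^k_1],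
    that is [U^k_d], commute with [U^l_1] for [k != l].  As [U^l_1] has simple
    spectrum, its eigenvectors would be eigenvectors of [U^k_d]; being unbiased
    with respect to the basis [k], they force [U^k_d] to be scalar, which is
    false because [d < d ^ N]. *)

Set Implicit Arguments.
Unset Strict Implicit.
Unset Printing Implicit Defensive.

Import Order.TTheory GRing.Theory Num.Theory.

Local Open Scope classical_set_scope.
Local Open Scope card_scope.
Local Open Scope ring_scope.
Local Open Scope sesquilinear_scope.

(** * Rank one projectors *)

Section Hilbert.
Variables (R : realType) (D : nat).
Local Notation C := R[i]%C.
Implicit Types (v w : 'cV[C]_D) (b c : 'I_D -> 'cV[C]_D).

Definition ketbra v : 'M[C]_D := v *m v^t*.

Lemma mulmx_braket v w : v^t* *m w = (braket v w)%:M.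
Proof. exact: mx11_scalar. Qed.

Lemma adjmxM m n p (A : 'M[C]_(m, n)) (B : 'M[C]_(n, p)) :
  (A *m B)^t* = B^t* *m A^t*.
Proof. by rewrite trmx_mul map_mxM. Qed.

Lemma adjmxZ m n (a : C) (A : 'M[C]_(m, n)) : (a *: A)^t* = a^* *: A^t*.
Proof. by apply/matrixP=> i j; rewrite !mxE rmorphM. Qed.

Lemma adjmx1 n : (1%:M : 'M[C]_n)^t* = 1%:M.
Proof. by rewrite trmx1 map_mx1. Qed.

Lemma braketC v w : braket w v = (braket v w)^*.
Proof.
by rewrite /braket -[in LHS](trmxCK v) -adjmxM mxE mxE.
Qed.

Lemma braketZ (a a' : C) v w : braket (a *: v) (a' *: w) = a^* * a' * braket v w.
Proof. by rewrite /braket adjmxZ -scalemxAl -scalemxAr scalerA mxE. Qed.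

Lemma ketbra_adj v : (ketbra v)^t* = ketbra v.
Proof. by rewrite /ketbra adjmxM trmxCK. Qed.

Lemma ketbra_mul v w : ketbra v *m w = braket v w *: v.
Proof. by rewrite /ketbra -mulmxA mulmx_braket mul_mx_scalar. Qed.

Lemma mxtrace_ketbraM v w : \tr (ketbra v *m ketbra w) = `|braket v w| ^+ 2.
Proof.
rewrite {2}/ketbra mulmxA ketbra_mul -scalemxAl mxtraceZ mxtrace_mulC.
by rewrite mulmx_braket mxtrace_scalar mulr1n (braketC v w) normCK.
Qed.

Lemma mxtrace_ketbra v : \tr (ketbra v) = braket v v.
Proof. by rewrite mxtrace_mulC mulmx_braket mxtrace_scalar mulr1n. Qed.

(** The square matrix whose columns are the basis vectors has its adjoint as left inverse, hence
    also as right inverse; the latter is the completeness relation. *)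
Lemma sum_ketbra b : orthonormal_basis b -> \sum_r ketbra (b r) = 1%:M.
Proof.
move=> ob; pose M := \matrix_(i < D, r < D) b r i ord0.
have /mulmx1C MM : M^t* *m M = 1%:M.
  apply/matrixP=> r s; rewrite !mxE -ob /braket mxE.
  by apply: eq_bigr=> i _; rewrite !mxE.
rewrite -MM; apply/matrixP=> i j; rewrite summxE !mxE.
by apply: eq_bigr=> r _; rewrite !mxE big_ord1 !mxE.
Qed.

(** Normal form for all operators below that are diagonal in [b]: products, adjoints and traces
    become pointwise computations with eigenvalues. *)
Definition diag_op b (l : 'I_D -> C) : 'M[C]_D := \sum_r l r *: ketbra (b r).

Lemma diag_op_ket b l r : orthonormal_basis b -> diag_op b l *m b r = l r *: b r.
Proof.
move=> ob; rewrite /diag_op mulmx_suml (bigD1 r) //= big1 => [|s /negPf rs].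
  by rewrite -scalemxAl ketbra_mul ob eqxx scale1r addr0.
by rewrite -scalemxAl ketbra_mul ob rs scale0r scaler0.
Qed.

Lemma eigenbasis_diag_op b l (A : 'M[C]_D) : orthonormal_basis b ->
  (forall r, A *m b r = l r *: b r) -> A = diag_op b l.
Proof.
move=> ob Ab; rewrite -[A]mulmx1 -(sum_ketbra ob) mulmx_sumr.
by apply: eq_bigr=> r _; rewrite /ketbra mulmxA Ab -scalemxAl.
Qed.

Lemma diag_op_adj b l : (diag_op b l)^t* = diag_op b (fun r => (l r)^*).
Proof.
rewrite /diag_op raddf_sum /= raddf_sum; apply: eq_bigr=> r _.
by rewrite /= adjmxZ ketbra_adj.
Qed.

Lemma diag_opM b l m : orthonormal_basis b ->
  diag_op b l *m diag_op b m = diag_op b (fun r => l r * m r).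
Proof.
move=> ob; apply: (eigenbasis_diag_op ob)=> r.
rewrite -mulmxA !(diag_op_ket _ _ ob) -scalemxAr diag_op_ket //.
by rewrite scalerA mulrC.
Qed.

Lemma diag_op1 b : orthonormal_basis b -> diag_op b (fun=> 1) = 1%:M.
Proof.
by move=> ob; rewrite -(sum_ketbra ob); apply: eq_bigr=> r _; rewrite scale1r.
Qed.

Lemma mxtrace_diag_op b l : orthonormal_basis b -> \tr (diag_op b l) = \sum_r l r.
Proof.
move=> ob; rewrite /diag_op raddf_sum; apply: eq_bigr=> r _.
by rewrite /= mxtraceZ mxtrace_ketbra ob eqxx mulr1.
Qed.

Lemma orthonormal_neq0 b r : orthonormal_basis b -> b r != 0.
Proof.
move=> ob; apply/eqP=> b0; have := ob r r.
by rewrite eqxx b0 /braket mulmx0 mxE => /esym/eqP; rewrite oner_eq0.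
Qed.

Lemma phase_class_eq (a : C) v : `|a| = 1 -> phase_class (a *: v) = phase_class v.
Proof.
move=> a1; have a0 : a != 0 by rewrite -normr_eq0 a1 oner_eq0.
apply/seteqP; split=> w [x x1 ->].
  by exists (x * a); rewrite ?normrM ?x1 ?a1 ?mulr1 ?scalerA.
by exists (x / a); rewrite ?normrM ?normfV ?x1 ?a1 ?divr1 // scalerA divfK.
Qed.

Lemma phase_class_refl v : phase_class v v.
Proof. by exists 1; rewrite ?normr1 ?scale1r. Qed.

Lemma unbiased_basis_class b c :
  unbiased (basis_class b) (basis_class c) <->
  forall r s, `|braket (b r) (c s)| ^+ 2 = D%:R^-1.
Proof.
split=> [H r s|H _ _ [r _ <-] [s _ <-] _ _ [x x1 ->] [y y1 ->]].
  by apply: (H (phase_class (b r)) (phase_class (c s)));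
    [exists r|exists s|exact: phase_class_refl|exact: phase_class_refl].
by rewrite braketZ 2!normrM norm_conjC x1 y1 !mul1r.
Qed.

Lemma not_unbiased_self b : (1 < D)%N -> orthonormal_basis b ->
  ~ unbiased (basis_class b) (basis_class b).
Proof.
move=> D1 ob /unbiased_basis_class H; pose r := Ordinal (ltnW D1).
have := H r r; rewrite ob eqxx normr1 expr1n => /(congr1 GRing.inv).
rewrite invrK invr1 => /esym/eqP; rewrite pnatr_eq1 => /eqP DE {r}.
by rewrite DE in D1.
Qed.

Definition orthogonal_family (A : 'I_D -> 'M[C]_D) :=
  forall j k, \tr (A j *m (A k)^t*) = D%:R * (j == k)%:R.

(** Orthogonality of the family says that the square matrix [L] of eigenvalues has orthogonal rows
    of norm squared [D]. Its columns then have the same property, which inverts the expansion of the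
    [A j] in projectors. *)
Lemma ketbra_family b (A : 'I_D -> 'M[C]_D) (l : 'I_D -> 'I_D -> C) r :
    orthonormal_basis b -> orthogonal_family A ->
    (forall j, A j = diag_op b (l j)) ->
  D%:R *: ketbra (b r) = \sum_j (l j r)^* *: A j.
Proof.
move=> ob oA Ab; pose L := \matrix_(j < D, s < D) l j s.
have D0 : D%:R != 0 :> C by rewrite pnatr_eq0 -lt0n (leq_trans _ (ltn_ord r)).
have LL : L *m (D%:R^-1 *: L^t*) = 1%:M.
  apply/matrixP=> j k; rewrite -scalemxAr !mxE.
  under eq_bigr do rewrite !mxE.
  have := oA j k; rewrite !Ab diag_op_adj diag_opM // mxtrace_diag_op //.
  by move=> ->; rewrite mulKf.
have /matrixP LL' := mulmx1C LL.
have lE s : \sum_j (l j r)^* * l j s = D%:R * (r == s)%:R.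
  have := LL' r s; rewrite -scalemxAl !mxE => <-; rewrite mulVKf //.
  by apply: eq_bigr=> j _; rewrite !mxE.
transitivity (\sum_s (\sum_j (l j r)^* * l j s) *: ketbra (b s)).
  rewrite (bigD1 r) //= lE eqxx mulr1 big1 ?addr0 // => s /negPf rs.
  by rewrite lE eq_sym rs mulr0 scale0r.
under eq_bigr do rewrite scaler_suml.
rewrite exchange_big /=; apply: eq_bigr=> j _.
rewrite Ab /diag_op scaler_sumr; apply: eq_bigr=> s _.
by rewrite scalerA.
Qed.

End Hilbert.

(** * Cardinals and simultaneous diagonalization *)

Lemma card_range_fin (T : finType) (U : Type) (f : T -> U) :
  injective f -> range f #= `I_#|T|.
Proof.
move=> finj; apply: card_eq_trans (inj_card_eq _) _; first by move=> x y _ _ /finj.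
rewrite card_eq_sym -[X in X #= _](_ : range (fun x : T => enum_rank x : nat) = _).
  by apply: inj_card_eq=> x y _ _ /ord_inj /enum_rank_inj.
apply/seteqP; split=> [_ [x _ <-]|i /= ilt]; first exact: ltn_ord.
by exists (enum_val (Ordinal ilt)); rewrite // enum_valK.
Qed.

Lemma card_enum (T : Type) (A : set T) n : A #= `I_n ->
  exists2 f : 'I_n -> T, injective f & range f = A.
Proof.
move=> An; have /card_bijP[g [h gK hK]] : [set: 'I_n] #= A.
  by rewrite card_eq_sym; apply: card_eq_trans An card_II.
have iT (i : 'I_n) : i \in [set: 'I_n] by rewrite inE.
exists (fun i => val (g (SigSub (iT i)))).
  by move=> i j /val_inj /(can_inj gK) [].
apply/seteqP; split=> [_ [i _ <-]|x Ax]; first exact: set_valP.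
have xA : x \in A by rewrite inE.
exists (val (h (SigSub xA))) => //.
rewrite (_ : SigSub _ = h (SigSub xA)); last exact: val_inj.
by rewrite hK.
Qed.

(** The operators and their adjoints are trigonalized together by a unitary matrix; a triangular
    matrix whose adjoint is triangular of the same kind is diagonal. The adjoint of a unitary is its
    inverse, so it commutes with whatever the operator commutes with. *)
Lemma codiagonalization (C : numClosedFieldType) n (As : seq 'M[C]_n) :
    {in As, forall A, A \is unitarymx} ->
    {in As &, forall A B, comm_mx A B} ->
  exists2 P : 'M[C]_n, P \is unitarymx &
    {in As, forall A, exists l, A = invmx P *m diag_mx l *m P}.
Proof.
move=> Au Ac; pose Bs := As ++ [seq A^t* | A <- As].
have adj_comm A B : A \is unitarymx -> comm_mx A B -> comm_mx (A^t*) B.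
  move=> uA cAB; rewrite -invmx_unitary // /comm_mx.
  have uA' := unitarymx_unit uA.
  by rewrite -[B in LHS](mulmxK uA') -cAB !mulmxA mulVmx // mul1mx.
have [|P uP /allP PB] := @cotrigonalization C n Bs.
  have AB A B : A \in As -> B \in Bs -> comm_mx A B.
    rewrite mem_cat => As_A /orP[As_B|/mapP[B' As_B' ->]]; first exact: Ac.
    by apply/esym/adj_comm; [exact: Au|exact: Ac].
  move=> A B; rewrite mem_cat => /orP[As_A Bs_B|/mapP[A' As_A' ->] Bs_B].
    exact: AB.
  by apply: adj_comm; [exact: Au|exact: AB].
exists P => // A As_A; have Pu := unitarymx_unit uP.
suff: similar_diag P A.
  move=> /similar_diagPex[l PAl]; exists l.
  by rewrite -conjVmx //; exact/similarLR.
apply/similar_diagPp => // i j; case: ltngtP => // [lt_ij|lt_ji] _.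
  by have /PB/is_trig_mxP-> : A \in Bs by rewrite mem_cat As_A.
have : A^t* \in Bs by rewrite mem_cat; apply/orP; right; apply/mapP; exists A.
move/PB => /is_trig_mxP -/(_ j i lt_ji)/eqP.
rewrite !conjumx// invmx_unitary// -[P as X in X *m _]trmxCK.
by rewrite -!map_mxM -!trmx_mul mulmxA 2!mxE conjC_eq0 => /eqP.
Qed.

(** * Joint eigenbases *)

Section MCC.
Variables (R : realType) (D : nat).
Local Notation C := R[i]%C.
Implicit Types (b c : 'I_D -> 'cV[C]_D) (A : 'I_D -> 'M[C]_D) (K : set 'M[C]_D).

Definition joint_eigenbasis A b :=
  orthonormal_basis b /\ exists l, forall j, A j = diag_op b (l j).

Lemma joint_eigenbasis_exists A : (forall j, A j \is unitarymx) ->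
  (forall j k, comm_mx (A j) (A k)) -> exists b, joint_eigenbasis A b.
Proof.
move=> uA cA; have [||P uP PA] := @codiagonalization C D [seq A j | j <- enum 'I_D].
- by move=> _ /mapP[j _ ->].
- by move=> _ _ /mapP[j _ ->] /mapP[k _ ->].
(* Since [A j] is [invmx P *m diag_mx l *m P] and [invmx P] is the adjoint of [P], the eigenvectors
   are the columns of that adjoint. *)
have ob : orthonormal_basis (fun r => (row r P)^t*).
  move=> r s; have /unitarymxP/matrixP/(_ r s) := uP.
  by rewrite !mxE /braket trmxCK => <-; rewrite !mxE; apply: eq_bigr=> i _; rewrite !mxE.
exists (fun r => (row r P)^t*); split=> //.
have /choice[l lP] : forall j, exists l : 'I_D -> C, A j = diag_op (fun r => (row r P)^t*) l.
  move=> j; have [l ->] := PA _ (map_f A (mem_enum 'I_D j)).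
  exists (l ord0); apply: eigenbasis_diag_op => // r.
  have PP : P *m (row r P)^t* = delta_mx r ord0.
    have /unitarymxP PP := uP.
    apply/matrixP=> i k.
    have /matrixP/(_ i r) := PP.
    rewrite !mxE ord1 eqxx andbT => <-; apply: eq_bigr=> m _.
    by rewrite !mxE.
  rewrite -!mulmxA PP mul_diag_mx invmx_unitary //.
  apply/matrixP=> i k; rewrite !mxE (bigD1 r) //= big1 => [|s /negPf sr].
    by rewrite !mxE !eqxx ord1 addr0 eqxx mulr1 mulrC.
  by rewrite !mxE sr /= !mulr0.
by exists l.
Qed.

(** By [ketbra_family] the projector on [b r] is a combination of the [A j], so each [c s] is an
    eigenvector of it. For some [r] it is not killed, and then [c s] is a multiple of [b r]. *)
Lemma joint_eigenbasis_uniq A b c : orthogonal_family A ->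
  joint_eigenbasis A b -> joint_eigenbasis A c -> basis_class b = basis_class c.
Proof.
wlog suff : b c / orthogonal_family A ->
    joint_eigenbasis A b -> joint_eigenbasis A c ->
    basis_class c `<=` basis_class b.
  by move=> H oA jb jc; apply/seteqP; split; apply: H.
move=> oA [ob [l Ab]] [oc [m Ac]] _ [s _ <-].
have D0 : D%:R != 0 :> C by rewrite pnatr_eq0 -lt0n (leq_trans _ (ltn_ord s)).
have [r rs] : exists r, braket (b r) (c s) != 0.
  apply/existsP; apply: contraT => /existsPn rs.
  have /eqP[] := orthonormal_neq0 s oc.
  rewrite -[c s]mul1mx -(sum_ketbra ob) mulmx_suml big1 // => r _.
  by rewrite ketbra_mul; move/(_ r): rs; rewrite negbK => /eqP->; rewrite scale0r.
have : exists x, ketbra (b r) *m c s = x *: c s.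
  exists (D%:R^-1 * \sum_j (l j r)^* * m j s).
  apply: (scalerI D0); rewrite scalerA mulVKf // scalemxAl.
  rewrite (ketbra_family r ob oA Ab) mulmx_suml scaler_suml.
  apply: eq_bigr=> j _.
  by rewrite -scalemxAl Ac diag_op_ket // scalerA.
rewrite ketbra_mul => -[x bc].
have x0 : x != 0.
  apply: contraTneq rs => x0; move/eqP: bc.
  by rewrite x0 scale0r scaler_eq0 (negPf (orthonormal_neq0 r ob)) orbF negbK.
have cb : c s = (braket (b r) (c s) / x) *: b r.
  by apply: (scalerI x0); rewrite -bc scalerA mulrC divfK.
exists r => //; rewrite cb phase_class_eq //.
(* Both vectors have norm 1, so the factor has modulus 1. *)
have := oc s s; rewrite {1 2}cb braketZ ob !eqxx mulr1 mulrC -normCK => /eqP.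
by rewrite sqrp_eq1 ?normr_ge0 // => /eqP.
Qed.

(** Expanding both projectors by [ketbra_family] writes [D ^ 2] times the squared modulus as a
    double sum of traces. Only the term at [j0], [j0] survives, where both operators are the
    identity, and it equals [D]. *)
Lemma family_unbiased A A' b c j0 :
    orthogonal_family A -> orthogonal_family A' -> A j0 = 1%:M -> A' j0 = 1%:M ->
    (forall j k, (j != j0) || (k != j0) -> \tr (A j *m (A' k)^t*) = 0) ->
    joint_eigenbasis A b -> joint_eigenbasis A' c ->
  unbiased (basis_class b) (basis_class c).
Proof.
move=> oA oA' A0 A'0 AA' [ob [l Ab]] [oc [m Ac]]; apply/unbiased_basis_class => r s.
have D0 : D%:R != 0 :> C by rewrite pnatr_eq0 -lt0n (leq_trans _ (ltn_ord s)).
(* The coefficients of the surviving term are conjugates of eigenvalues of the identity, hence 1. *)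
have eig1 b' (l' : 'I_D -> C) t : orthonormal_basis b' -> 1%:M = diag_op b' l' -> l' t = 1.
  move=> ob' E; apply/eqP; rewrite -subr_eq0 -[_ == 0]orbF.
  rewrite -(negPf (orthonormal_neq0 t ob')) -scaler_eq0 scalerBl subr_eq0 scale1r.
  by rewrite -(diag_op_ket _ _ ob') -E mul1mx.
apply: (mulfI D0); apply: (mulfI D0); rewrite divff // mulr1 -mxtrace_ketbraM.
rewrite -!mxtraceZ scalemxAr scalemxAl -(ketbra_adj (c s)).
rewrite (ketbra_family r ob oA Ab).
rewrite -[D%:R in X in _ *m X]conjC_nat -adjmxZ (ketbra_family s oc oA' Ac).
rewrite mulmx_suml raddf_sum (bigD1 j0) //= [X in _ + X]big1 ?addr0.
  rewrite raddf_sum /= raddf_sum /= mulmx_sumr raddf_sum (bigD1 j0) //= big1 ?addr0.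
    rewrite adjmxZ -scalemxAl -scalemxAr !mxtraceZ A0 A'0 adjmx1 mulmx1 mxtrace1.
    by rewrite (eig1 _ (l j0) r ob) -?A0 // (eig1 _ (m j0) s oc) -?A'0 // !conjC1 !mul1r.
  move=> k k0; rewrite adjmxZ -scalemxAl -scalemxAr !mxtraceZ AA' ?mulr0 //.
  by rewrite k0 orbT.
move=> j jj0; rewrite raddf_sum /= raddf_sum /= mulmx_sumr raddf_sum big1 // => k _ /=.
by rewrite adjmxZ -scalemxAl -scalemxAr !mxtraceZ AA' ?mulr0 // jj0.
Qed.

End MCC.

(** * From MCCs to maximal MUBs *)

(** Used to complete a class of [D.-1] operators by the identity to a family indexed by ['I_D], with
    the identity at index 0. *)
Lemma card_enum1 (T : Type) (x : T) (K : set T) D (D0 : (0 < D)%N) :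
    ~ K x -> K #= `I_D.-1 ->
  exists A : 'I_D -> T, [/\ injective A, A (Ordinal D0) = x
    & K = A @` [set j | j != Ordinal D0]].
Proof.
case: D D0 => // n D0 Kx /card_enum[f finj fK].
pose A (i : 'I_n.+1) := oapp f x (unlift (Ordinal D0) i).
have Kf j : K (f j) by rewrite -fK; exists j.
exists A; split.
- move=> i j; rewrite /A; case: unliftP => [i' ->|->] /=; case: unliftP => [j' ->|->] //=.
  + by move/finj ->.
  + by move=> E; case: Kx; rewrite -E.
  + by move=> E; case: Kx; rewrite E.
- by rewrite /A unlift_none.
- rewrite -[in LHS]fK; apply/seteqP; split=> [_ [j _ <-]|_ [j /= jj0 <-]].
    exists (lift (Ordinal D0) j); last by rewrite /A liftK.
    by apply/eqP => /esym/eqP; rewrite (negPf (neq_lift _ _)).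
  rewrite /A; case: unliftP jj0 => [i ->|->] /=; last by move/eqP.
  by exists i.
Qed.

Section MCC_MUB.
Variables (R : realType) (D : nat).
Local Notation C := R[i]%C.
Implicit Types (b c : 'I_D -> 'cV[C]_D) (A : 'I_D -> 'M[C]_D) (K : set 'M[C]_D)
  (U : set (set 'M[C]_D)).

Lemma MCC_families U : (0 < D)%N -> is_MCC U ->
  exists (F : set 'M[C]_D -> 'I_D -> 'M[C]_D) (j0 : 'I_D),
  [/\ forall K, U K ->
        [/\ F K j0 = 1%:M, K = F K @` [set j | j != j0], orthogonal_family (F K),
            forall j, F K j \is unitarymx
          & forall j k, comm_mx (F K j) (F K k)]
    & forall K L, U K -> U L -> K <> L -> forall j k, (j != j0) || (k != j0) ->
        \tr (F K j *m (F L k)^t*) = 0].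
Proof.
move=> D0 [V [[_ uV oV V1] _ UK UKL]]; pose j0 := Ordinal D0.
have /choice[F FP] : forall K, exists A : 'I_D -> 'M[C]_D, U K ->
    [/\ injective A, A j0 = 1%:M & K = A @` [set j | j != j0]].
  (* Sets outside [U] get a dummy family, so that [choice] yields a total function. *)
  move=> K; have [UK'|nUK] := pselect (U K); last by exists (fun=> 1%:M).
  have [KV Kn _] := UK _ UK'.
  have [|A] := card_enum1 (x := 1%:M) D0 _ Kn; last by exists A.
  by move=> /KV[_]; apply.
have FK K j : U K -> j != j0 -> K (F K j).
  move=> /FP[_ _ KE] jj0; suff : (F K @` [set j | j != j0]) (F K j) by rewrite -KE.
  by exists j.
have FV K j : U K -> V (F K j).
  move=> UK'; have [->|jj0] := eqVneq j j0; first by have [_ ->] := FP _ UK'.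
  by have [KV _ _] := UK _ UK'; have /KV[] := FK _ _ UK' jj0.
have F1 K j : U K -> j != j0 -> F K j <> 1%:M.
  move=> UK' jj0; have [KV _ _] := UK _ UK'.
  by have /KV[] := FK _ _ UK' jj0.
exists F, j0; split=> [K UK'|K L UK' UL KL j k jk].
  have [inj F0 KE] := FP _ UK'; split=> // [j k|j|j k].
  - have [->|jk] := eqVneq j k; last by rewrite mulr0 oV //; [exact: FV..|by move/inj/eqP; rewrite (negPf jk)].
    by have /uV/unitarymxP-> := FV _ k UK'; rewrite mxtrace1 mulr1.
  - exact/uV/FV.
  - have [->|jj0] := eqVneq j j0; first by rewrite F0 /comm_mx mul1mx mulmx1.
    have [->|kj0] := eqVneq k j0; first by rewrite F0 /comm_mx mul1mx mulmx1.
    by have [_ _] := UK _ UK'; apply; apply: FK.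
apply: oV; [exact: FV..|] => E.
(* By [E] the two operators coincide: if just one index is [j0], a class contains the identity; if
   neither is, the classes meet. *)
have [jj0|jj0] := eqVneq j j0; have [kj0|kj0] := eqVneq k j0.
- by move: jk; rewrite jj0 kj0 eqxx.
- by apply: (F1 L k) => //; rewrite -E jj0; have [_ ->] := FP _ UK'.
- by apply: (F1 K j) => //; rewrite E kj0; have [_ ->] := FP _ UL.
have : (K `&` L) (F K j) by split; [|rewrite E]; exact: FK.
by rewrite (UKL _ _ UK' UL KL).
Qed.

Lemma common_eigenbasisP K A b j0 : A j0 = 1%:M -> K = A @` [set j | j != j0] ->
  is_common_eigenbasis K b <-> joint_eigenbasis A b.
Proof.
move=> A0 ->; split=> -[ob H]; split=> //.
  suff /choice[l lP] : forall j, exists l, A j = diag_op b l by exists l.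
  move=> j.
  have [->|jj0] := eqVneq j j0.
    by exists (fun=> 1); rewrite A0 diag_op1.
  have /choice[l lP] := H (A j) (ex_intro2 _ _ j jj0 erefl).
  by exists l; exact: eigenbasis_diag_op.
move: H => [l Al] _ [j _ <-] r; exists (l j r).
by rewrite Al diag_op_ket.
Qed.

(** Turns [beta], defined by a relation between classes and bases, into the image of a function [e]
    on the classes. *)
Lemma MCC_eigenbases U : (0 < D)%N -> is_MCC U ->
  exists e : set 'M[C]_D -> 'I_D -> 'cV[C]_D,
  [/\ forall K, U K -> is_common_eigenbasis K (e K),
      forall K b, U K -> is_common_eigenbasis K b -> basis_class b = basis_class (e K)
    & forall K L, U K -> U L -> K <> L ->
        unbiased (basis_class (e K)) (basis_class (e L))].
Proof.
move=> D0 /(MCC_families D0)[F [j0 [FP Fo]]].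
have /choice[e eP] : forall K, exists b, U K -> joint_eigenbasis (F K) b.
  move=> K; have [UK|nUK] := pselect (U K); last by exists (fun=> 0).
  have [_ _ _ uF cF] := FP _ UK.
  by have [b] := joint_eigenbasis_exists uF cF; exists b.
exists e; split=> [K UK|K b UK|K L UK UL KL].
- have [F0 KE _ _ _] := FP _ UK.
  by apply/(common_eigenbasisP _ F0 KE)/eP.
- have [F0 KE oF _ _] := FP _ UK.
  move/(common_eigenbasisP _ F0 KE) => jb.
  exact: joint_eigenbasis_uniq oF jb (eP _ UK).
have [F0 _ oF _ _] := FP _ UK; have [F0' _ oF' _ _] := FP _ UL.
exact: family_unbiased oF oF' F0 F0' (Fo _ _ UK UL KL) (eP _ UK) (eP _ UL).
Qed.

Lemma beta_maxMUB U : (1 < D)%N -> is_MCC U -> is_maxMUB (beta U).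
Proof.
move=> D1 mU; have [e [eP eU eO]] := MCC_eigenbases (ltnW D1) mU.
have bE : beta U = [set basis_class (e K) | K in U].
  apply/seteqP; split=> [_ [K [b [UK Kb ->]]]|_ [K UK <-]].
    by exists K => //; rewrite (eU K b).
  by exists K, (e K); split=> //; exact: eP.
rewrite bE; split.
- have [_ [_ Un _ _]] := mU; apply: card_eq_trans Un.
  apply: inj_card_eq => K L; rewrite !inE => UK UL E.
  (* Two classes with the same eigenbasis would make that basis unbiased to itself, so [beta U] has
     as many elements as [U]. *)
  apply: contrapT => KL; have [oL _] := eP _ UL.
  by apply: (not_unbiased_self D1 oL); rewrite -{1}E; exact: eO.
- by move=> _ [K UK <-]; exists (e K) => //; have [] := eP _ UK.
- move=> _ _ [K UK <-] [L UL <-] KL; apply: eO => // E.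
  by rewrite E in KL.
Qed.

Lemma maxMUB_listing (B : set (set (set 'cV[C]_D))) : is_maxMUB B ->
  exists psi, is_listing B psi.
Proof.
move=> [/card_enum[X Xinj XB] Bb _].
have /choice[psi psiP] : forall k : 'I_D.+1, exists b : 'I_D -> 'cV[C]_D,
    orthonormal_basis b /\ X k = basis_class b.
  move=> k; have [|b] := Bb (X k); first by rewrite -XB; exists k.
  by exists b.
have XE : (fun k => basis_class (psi k)) = X.
  by apply/funext=> k; have [_ ->] := psiP k.
exists psi; split=> [k|]; first by have [] := psiP k.
rewrite XE; split=> [k _|i j _ _ /Xinj //|Y BY].
  by rewrite /= -XB; exists k.
by move: BY; rewrite -XB.
Qed.

End MCC_MUB.

(** * The MCC of a maximal MUB *)

Lemma card_image_finset (T : finType) (U : Type) (A : {set T}) (f : T -> U) :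
  {in A &, injective f} -> [set f x | x in [set` A]] #= `I_#|A|.
Proof.
move=> finj; rewrite -[X in `I_X]card_ord.
rewrite (_ : [set _ | _ in _] = range (fun i : 'I_#|A| => f (enum_val i))).
  apply: card_range_fin=> i j /finj E; apply: enum_val_inj.
  by apply: E; exact: enum_valP.
apply/seteqP; split=> [_ [x /= xA <-]|_ [i _ <-]].
  by exists (enum_rank_in xA x) => //; rewrite enum_rankK_in.
by exists (enum_val i) => //; exact: enum_valP.
Qed.

(** Common criterion for [alpha] and for the Pauli operators: the counting and disjointness
    conditions are moved from sets of matrices to a finite index type. *)
Lemma is_MCC_family (R : realType) (D : nat) (I : finType) (G : I -> 'M[R[i]%C]_D)
    (i0 : I) (cl : 'I_D.+1 -> {set I}) :
    (1 < D)%N -> #|I| = (D ^ 2)%N -> G i0 = 1%:M ->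
    (forall i, G i \is unitarymx) ->
    (forall i j, i != j -> op_orthogonal (G i) (G j)) ->
    (forall k, i0 \notin cl k) -> (forall k, #|cl k| = D.-1) ->
    (forall i k l, i \in cl k -> i \in cl l -> k = l) ->
    (forall k, {in cl k &, forall i j, comm_mx (G i) (G j)}) ->
  is_MCC [set [set G i | i in [set` cl k]] | k in [set: 'I_D.+1]].
Proof.
move=> D1 cI G0 uG oG cl0 clD clI clC.
(* Orthogonality separates the operators: two equal unitaries would have trace product [D], not
   0. *)
have Ginj : injective G.
  move=> i j E; apply: contrapT => /eqP/oG; rewrite /op_orthogonal -E.
  rewrite (unitarymxP (uG i)) mxtrace1 => /eqP.
  by rewrite pnatr_eq0 -leqn0 leqNgt ltnW.
have Gin i k : [set G i | i in [set` cl k]] (G i) -> i \in cl k.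
  by move=> [j jk /Ginj <-].
exists (range G); split.
- split.
  + by rewrite -cI; exact: card_range_fin.
  + by move=> _ [i _ <-]; exact: uG.
  + move=> _ _ [i _ <-] [j _ <-] Gij.
    by have [ij|ij] := eqVneq i j; [case: Gij; rewrite ij|exact: oG].
  + by exists i0.
- rewrite -[X in `I_X]card_ord; apply: card_range_fin => k l E; apply: contrapT => /eqP kl.
  (* As [D > 1] the classes are nonempty, so equal classes share an index. *)
  have /card_gt0P[i ik] : (0 < #|cl k|)%N by rewrite clD -subn1 subn_gt0.
  have il : i \in cl l by apply: Gin; rewrite -E; exists i.
  by move/eqP: kl; apply; exact: clI ik il.
- move=> _ [k _ <-]; split.
  + move=> _ [i /= ik <-]; split; first by exists i.
    by rewrite /= -G0 => /Ginj i0E; have := cl0 k; rewrite -i0E ik.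
  + by rewrite -(clD k); apply: card_image_finset => i j _ _; exact: Ginj.
  + by move=> _ _ [i /= ik <-] [j /= jk <-]; exact: (clC k).
- move=> _ _ [k _ <-] [l _ <-] kl; apply/seteqP; split=> // _ [[i /= ik <-] /Gin il].
  by apply: kl; rewrite (clI _ _ _ ik il).
Qed.

(** * Complex exponentials and primitive roots of unity *)

Section Expi.
Variable R : realType.
Local Notation C := R[i]%C.
Implicit Types x y : R.

Lemma expiD x y : expi (x + y) = expi x * expi y.
Proof.
rewrite /expi cosD sinD; apply/eqP; rewrite eq_complex /=.
by rewrite eqxx /= addrC.
Qed.

Lemma expi0 : expi 0 = 1 :> C.
Proof. by rewrite /expi cos0 sin0. Qed.

Lemma expiMn x n : expi (n%:R * x) = expi x ^+ n.
Proof.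
elim: n => [|n IH]; first by rewrite mul0r expi0.
by rewrite -natr1 mulrDl mul1r expiD IH exprSr.
Qed.

Lemma conj_expi x : (expi x)^* = expi (- x).
Proof. by rewrite /expi cosN sinN. Qed.

Lemma expi_conjM x : expi x * (expi x)^* = 1.
Proof. by rewrite conj_expi -expiD subrr expi0. Qed.

Lemma norm_expi x : `|expi x| = 1.
Proof. by apply/eqP; rewrite -sqrp_eq1 ?normr_ge0 // normCK expi_conjM. Qed.

(** Half-angle formula: [cos x] is 1 minus twice the square of [sin (x / 2)], and this sine is
    positive. *)
Lemma expi_neq1 x : 0 < x < 2 * pi -> expi x != 1.
Proof.
move=> /andP[x0 xpi]; apply/eqP => -[cosx _].
have : 0 < sin (x / 2) by apply: sin_gt0_pi; lra.
have := cosD (x / 2) (x / 2); rewrite -splitr cosx.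
have := cos2Dsin2 (x / 2); rewrite !expr2; nra.
Qed.

Definition root_unity n : C := expi (2 * pi / n%:R).

Lemma root_unity_expr n k : root_unity n ^+ k = expi (2 * pi * k%:R / n%:R).
Proof. by rewrite -expiMn; congr expi; ring. Qed.

Lemma root_unity_prim n : (0 < n)%N -> n.-primitive_root (root_unity n).
Proof.
move=> n0; have n0' : 0 < n%:R :> R by rewrite ltr0n.
apply/andP; split=> //; apply/forallP => i.
rewrite unity_rootE root_unity_expr; apply/eqP.
have [->|ne] := eqVneq i.+1 n.
  rewrite mulfK; last by rewrite gt_eqF.
  rewrite (_ : 2 * pi = pi + pi :> R); last by ring.
  rewrite /expi.
  by rewrite cosDpi sinDpi cospi sinpi opprK oppr0 eqxx.
apply/negbTE/expi_neq1; rewrite ?divr_gt0 ?mulr_gt0 ?pi_gt0 ?ltr0n //=.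
by rewrite -mulrA gtr_pMr ?mulr_gt0 ?pi_gt0 // ltr_pdivrMr // mul1r ltr_nat ltn_neqAle ne ltn_ord.
Qed.

Lemma root_unity_conjM n : root_unity n * (root_unity n)^* = 1.
Proof. exact: expi_conjM. Qed.

End Expi.

Lemma sum_expr_root_unity (F : fieldType) (z : F) n :
  z ^+ n = 1 -> z != 1 -> \sum_(r < n) z ^+ r = 0.
Proof.
move=> zn; rewrite -subr_eq0 => z1; apply: (mulfI z1).
by rewrite mulr0 -subrX1 zn subrr.
Qed.

(** * Orthogonality and eigenbases of the operators of [alpha] *)

Section Alpha.
Variables (R : realType) (D : nat).
Local Notation C := R[i]%C.
Local Notation w := (root_unity R D).
Variable psi : 'I_D.+1 -> 'I_D -> 'cV[C]_D.
Hypothesis D1 : (1 < D)%N.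
Hypothesis ob : forall k, orthonormal_basis (psi k).
Hypothesis ub : forall k l, k != l ->
  unbiased (basis_class (psi k)) (basis_class (psi l)).

Let wP : D.-primitive_root w := root_unity_prim R (ltnW D1).

Lemma alpha_opE k j : alpha_op psi k j = diag_op (psi k) (fun r => w ^+ (j * r.+1)).
Proof. by apply: eq_bigr => r _; rewrite root_unity_expr. Qed.

Lemma alpha_op0 k : alpha_op psi k 0 = 1%:M.
Proof.
by rewrite alpha_opE -(diag_op1 (ob k)); congr diag_op; apply/funext=> r; rewrite mul0n.
Qed.

Lemma alpha_opM k i j : alpha_op psi k i *m alpha_op psi k j = alpha_op psi k (i + j).
Proof.
rewrite !alpha_opE diag_opM //; congr diag_op; apply/funext=> r.
by rewrite -exprD mulnDl.
Qed.

Lemma alpha_op_unitary k j : alpha_op psi k j \is unitarymx.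
Proof.
apply/unitarymxP; rewrite alpha_opE diag_op_adj diag_opM // -(diag_op1 (ob k)).
by congr diag_op; apply/funext=> r; rewrite rmorphXn -exprMn root_unity_conjM expr1n.
Qed.

Lemma sum_root_unity_expr j : (0 < j < D)%N -> \sum_(r < D) w ^+ (j * r.+1) = 0.
Proof.
(* The shift in [r.+1] contributes only a common factor [w ^+ j]; what remains is a geometric sum of
   ratio [w ^+ j], which differs from 1. *)
move=> /andP[j0 jD]; under eq_bigr do rewrite mulnS exprD exprM.
rewrite -mulr_sumr sum_expr_root_unity ?mulr0 //.
  by rewrite exprAC (prim_expr_order wP) expr1n.
by rewrite -(expr0 w) (eq_prim_root_expr wP) eqn_mod_dvd // subn0 gtnNdvd.
Qed.

Lemma alpha_op_orthogonal k i j : (i < j < D)%N ->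
  op_orthogonal (alpha_op psi k i) (alpha_op psi k j).
Proof.
move=> /andP[ij jD]; rewrite /op_orthogonal !alpha_opE diag_op_adj diag_opM //.
(* Conjugation turns the negative exponent [i - j] into the natural number [j - i]. *)
rewrite mxtrace_diag_op //; apply/eqP; rewrite -conjC_eq0 rmorph_sum.
apply/eqP; rewrite -[RHS](@sum_root_unity_expr (j - i)); last first.
  by rewrite subn_gt0 ij (leq_ltn_trans (leq_subr _ _)).
apply: eq_bigr => r _; rewrite /= rmorphM /= conjCK -{1}(subnK (ltnW ij)) mulnDl exprD.
by rewrite mulrCA rmorphXn -exprMn [X in _ * X ^+ _]mulrC root_unity_conjM expr1n mulr1.
Qed.

(** All traces of products of two projectors are [1 / D], so the trace factors into the two
    eigenvalue sums, and the one for [j] vanishes. *)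
Lemma alpha_op_orthogonal_neq k l i j : k != l -> (i < D)%N -> (0 < j < D)%N ->
  op_orthogonal (alpha_op psi k i) (alpha_op psi l j).
Proof.
move=> kl iD jD; rewrite /op_orthogonal !alpha_opE diag_op_adj.
have /unbiased_basis_class kl' := ub kl.
rewrite /diag_op mulmx_suml raddf_sum big1 // => r _ /=.
rewrite mulmx_sumr raddf_sum /=.
under eq_bigr do rewrite -scalemxAl -scalemxAr !mxtraceZ mxtrace_ketbraM kl' mulrA.
rewrite -mulr_suml -mulr_sumr -rmorph_sum /= sum_root_unity_expr //.
by rewrite conjC0 mulr0 mul0r.
Qed.

Lemma alpha_MCC : is_MCC (alpha psi).
Proof.
(* [None] is the identity; the pairs account for the other [(D + 1) (D - 1)] operators, with [j.+1]
   because the exponents start at 1. *)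
pose G (x : option ('I_D.+1 * 'I_D.-1)) :=
  if x is Some (k, j) then alpha_op psi k j.+1 else 1%:M.
pose cl (k : 'I_D.+1) : {set option ('I_D.+1 * 'I_D.-1)} :=
  [set Some (k, j) | j in 'I_D.-1]%SET.
have ltD (j : 'I_D.-1) : (j.+1 < D)%N by rewrite -ltn_predRL.
have clE k : [set alpha_op psi k j | j in [set j : nat | (0 < j < D)%N]] =
    [set G i | i in [set` cl k]].
  apply/seteqP; split=> [_ [[//|j] /= jD <-]|_ [_ /imsetP[j _ ->] <-]].
    have jD' : (j < D.-1)%N by rewrite ltn_predRL.
    by exists (Some (k, Ordinal jD')) => //; apply/imsetP; exists (Ordinal jD').
  by exists j.+1 => //=; rewrite ltD.
have -> : alpha psi = [set [set G i | i in [set` cl k]] | k in [set: 'I_D.+1]].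
  by apply/seteqP; split=> _ [k _ <-]; exists k => //; rewrite clE.
have adj0 (A B : 'M[C]_D) : op_orthogonal A B -> op_orthogonal B A.
  move=> AB; rewrite /op_orthogonal -[B in LHS]trmxCK -adjmxM trace_map_mx.
  by rewrite mxtrace_tr AB rmorph0.
apply: (@is_MCC_family _ _ _ G None cl) => //.
- by rewrite card_option card_prod !card_ord; nia.
- move=> [[k j]|] /=; first exact: alpha_op_unitary.
  by apply/unitarymxP; rewrite adjmx1 mulmx1.
- have o1 k (j : 'I_D.-1) : op_orthogonal (alpha_op psi k j.+1) 1%:M.
    by apply/adj0; rewrite -(alpha_op0 k); apply: alpha_op_orthogonal; rewrite ltD.
  move=> [[k j]|] [[l i]|] //= ne; last exact/adj0/o1.
  have [kl|kl] := eqVneq k l; last by apply: alpha_op_orthogonal_neq => //=.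
  rewrite -kl in ne *; have [ji|ij|E] := ltngtP j i.
  + by apply: alpha_op_orthogonal; rewrite ltnS ji ltD.
  + by apply/adj0/alpha_op_orthogonal; rewrite ltnS ij ltD.
  + by move: ne; rewrite (val_inj E) eqxx.
- by move=> k; apply/imsetP => -[].
- by move=> k; rewrite card_imset ?card_ord // => i j [].
- by move=> i k l /imsetP[j _ ->] /imsetP[j' _ [->]].
- move=> k _ _ /imsetP[i _ ->] /imsetP[j _ ->].
  by rewrite /comm_mx /= !alpha_opM addnC.
Qed.

Lemma alpha_eigenbasis k :
  is_common_eigenbasis [set alpha_op psi k j | j in [set j : nat | (0 < j < D)%N]] (psi k).
Proof.
split=> // _ [j _ <-] r; exists (w ^+ (j * r.+1)).
by rewrite alpha_opE diag_op_ket.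
Qed.

Lemma beta_alpha : beta (alpha psi) = [set basis_class (psi k) | k in [set: 'I_D.+1]].
Proof.
apply/seteqP; split=> [X [K [b [UK Kb ->]]]|_ [k _ <-]]; last first.
  eexists; exists (psi k); split; [by exists k| exact: alpha_eigenbasis|by []].
(* Both [b] and [psi k] are eigenbases of the same class, so uniqueness identifies them. *)
have [e [_ eU _]] := MCC_eigenbases (ltnW D1) alpha_MCC.
move: (UK) (Kb) => [k _ KE] _; exists k => //.
rewrite (eU _ _ UK Kb); apply: eU => //.
by rewrite -KE; exact: alpha_eigenbasis.
Qed.

End Alpha.

Lemma listing_unbiased (R : realType) D (B : set (set (set 'cV[R[i]%C]_D))) psi :
    is_maxMUB B -> is_listing B psi ->
  forall k l, k != l -> unbiased (basis_class (psi k)) (basis_class (psi l)).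
Proof.
move=> [_ _ uB] [_ [psiB psiI _]] k l kl.
apply: uB; [exact: psiB|exact: psiB|].
by move/psiI => E; move: kl; rewrite E ?inE ?eqxx.
Qed.

Lemma alpha_beta_preimage (R : realType) D (B : set (set (set 'cV[R[i]%C]_D))) psi :
  (1 < D)%N -> is_maxMUB B -> is_listing B psi -> beta_preimage B (alpha psi).
Proof.
move=> D1 mB lB; have ub := listing_unbiased mB lB.
have [ob [psiB _ psiS]] := lB.
split; first exact: alpha_MCC.
rewrite beta_alpha //; apply/seteqP; split=> [_ [k _ <-]|X /psiS //].
exact: psiB.
Qed.

(** * Non-isomorphism *)

Section SimpleSpectrum.
Variables (R : realType) (D : nat).
Local Notation C := R[i]%C.
Implicit Types (b c : 'I_D -> 'cV[C]_D) (l m : 'I_D -> C).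

Lemma braket_mulmx (A : 'M[C]_D) (u v : 'cV[C]_D) :
  braket u (A *m v) = braket (A^t* *m u) v.
Proof. by rewrite /braket adjmxM trmxCK mulmxA. Qed.

Lemma braket_diag_op b l r (u : 'cV[C]_D) : orthonormal_basis b ->
  braket (b r) (diag_op b l *m u) = l r * braket (b r) u.
Proof.
move=> ob; rewrite braket_mulmx diag_op_adj diag_op_ket //.
by rewrite -[u in LHS]scale1r braketZ conjCK mulr1.
Qed.

(** Pairing the eigenvalue equation with [b t] shows that [l s - l t] times the component of [u]
    along [b t] is 0, so only the component along [b s] remains. *)
Lemma diag_op_simple_eigenvector b l s (u : 'cV[C]_D) :
    orthonormal_basis b -> injective l ->
  diag_op b l *m u = l s *: u -> u = braket (b s) u *: b s.
Proof.
move=> ob linj lu; rewrite -[LHS]mul1mx -(sum_ketbra ob) mulmx_suml.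
rewrite (bigD1 s) //= big1 => [|t ts]; first by rewrite ketbra_mul addr0.
rewrite ketbra_mul; have := braket_diag_op l t u ob.
rewrite lu -[b t in LHS]scale1r braketZ conjC1 mul1r => /eqP.
rewrite -subr_eq0 -mulrBl mulf_eq0 subr_eq0 => /orP[/eqP/linj ts'|/eqP->].
  by rewrite ts' eqxx in ts.
by rewrite scale0r.
Qed.

(* Each [c r] is an eigenvector of [diag_op b l] because [m] is injective; all its
   components along [b] are non-zero, so all [l r] equal its eigenvalue. *)
Lemma comm_unbiased_diag_op_scalar b c l m :
    orthonormal_basis b -> orthonormal_basis c ->
    unbiased (basis_class b) (basis_class c) -> injective m ->
    comm_mx (diag_op b l) (diag_op c m) ->
  forall r r', l r = l r'.
Proof.
move=> ob oc /unbiased_basis_class bc minj lm r r'.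
have D0 : D%:R != 0 :> C by rewrite pnatr_eq0 -lt0n (leq_trans _ (ltn_ord r)).
have : diag_op b l *m c r = braket (c r) (diag_op b l *m c r) *: c r.
  apply: (diag_op_simple_eigenvector oc minj).
  by rewrite mulmxA -lm -mulmxA diag_op_ket // -scalemxAr.
set x := braket _ _ => lc.
suff lx t : l t = x by rewrite !lx.
have bn0 : braket (b t) (c r) != 0.
  have /eqP := bc t r; apply: contraTneq => ->.
  by rewrite normr0 expr0n eq_sym invr_eq0.
apply: (mulIf bn0); rewrite -braket_diag_op // lc -[b t in LHS]scale1r braketZ.
by rewrite conjC1 mul1r.
Qed.

End SimpleSpectrum.

Section NonIsomorphism.
Variables (R : realType) (D : nat).
Local Notation C := R[i]%C.
Variable psi : 'I_D.+1 -> 'I_D -> 'cV[C]_D.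
Hypothesis D1 : (1 < D)%N.
Hypothesis ob : forall k, orthonormal_basis (psi k).
Hypothesis ub : forall k l, k != l ->
  unbiased (basis_class (psi k)) (basis_class (psi l)).

(* [exprZn] needs a non-trivial ring, which ['M_D] is not for an abstract [D]. *)
Lemma exprmxZ (a : C) (A : 'M[C]_D) n : (a *: A) ^+ n = a ^+ n *: A ^+ n.
Proof.
elim: n => [|n IH]; first by rewrite !expr0 scale1r.
by rewrite !exprS IH -!mulmxE -scalemxAl -scalemxAr scalerA.
Qed.

Lemma alpha_opX k j n : alpha_op psi k j ^+ n = alpha_op psi k (n * j).
Proof.
elim: n => [|n IH]; first by rewrite expr0 mul0n alpha_op0.
by rewrite exprS IH -mulmxE alpha_opM.
Qed.

Lemma alpha_op_not_comm k l n : k != l -> (0 < n < D)%N ->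
  ~ comm_mx (alpha_op psi k n) (alpha_op psi l 1).
Proof.
move=> kl /andP[n0 nD]; rewrite !alpha_opE => cm.
have wP := root_unity_prim R (ltnW D1).
have minj : injective (fun r : 'I_D => root_unity R D ^+ (1 * r.+1)).
  move=> r s /eqP; rewrite !mul1n (eq_prim_root_expr wP) -[r.+1]addn1 -[s.+1]addn1 eqn_modDr !modn_small //.
  by move/eqP/val_inj.
(* The eigenvalues at the first two indices are [w ^+ n] and [w ^+ (2 * n)] for [w] the [D]-th root
   of unity; their equality would make [D] divide [n]. *)
have := comm_unbiased_diag_op_scalar (ob k) (ob l) (ub kl) minj cm
  (Ordinal (ltnW D1)) (Ordinal D1).
move/eqP; rewrite /= muln1 mulnS muln1 -{1}[n]addn0 (eq_prim_root_expr wP) eqn_modDl.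
by rewrite mod0n modn_small // eq_sym eqn0Ngt n0.
Qed.

(** The relation in [U] makes [A ^+ n] commute with [B] for all operators [A], [B]. An isomorphism
    carries this over to [alpha psi], contradicting [alpha_op_not_comm]. *)
Lemma not_isomorphic_alpha (U : set (set 'M[C]_D)) n : (0 < n < D)%N ->
    (forall A B, operators U A -> operators U B ->
       exists2 z : C, z ^+ n = 1 & A *m B = z *: (B *m A)) ->
  ~ MCC_isomorphic U (alpha psi).
Proof.
move=> nD Ucomm [c [c' [c1 c'1 [f []]]]].
set V := scale_MCC c U; set V' := scale_MCC c' _ => _ fM fV.
have VG A : operators V A -> MCC_group V A by move=> VA G [_ VG]; exact: VG.
have GM A B : MCC_group V A -> MCC_group V B -> MCC_group V (A *m B).
  by move=> GA GB G GU; have [[_ _ + _] _] := GU; apply; [exact: GA|exact: GB].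
have preim k : exists2 A, operators V A &
    exists2 x : C, x != 0 & f A = x *: alpha_op psi k 1.
  have : operators V' (c' (alpha_op psi k 1) *: alpha_op psi k 1).
    eexists; first by eexists; [exists k|].
    by exists (alpha_op psi k 1) => //; exists 1%N => //=; rewrite D1.
  rewrite -fV => -[A VA fA]; exists A => //; exists (c' (alpha_op psi k 1)) => //.
  by rewrite -normr_eq0 c'1 oner_eq0.
have VK A : operators V A -> exists2 x : C, exists2 A', operators U A' & A = x *: A' & true.
  move=> [_ [K UK <-] [A' KA' <-]]; exists (c A') => //; exists A' => //.
  by exists K.
have [A VA [x x0 fA]] := preim ord0; have [B VB [y y0 fB]] := preim ord_max.
(* Scaling multiplies both sides by the same scalar, so the relation of [U] survives. *)
have AB : exists2 z : C, z ^+ n = 1 & A *m B = z *: (B *m A).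
  have [a [A' UA' ->] _] := VK _ VA; have [b [B' UB' ->] _] := VK _ VB.
  have [z zn E] := Ucomm _ _ UA' UB'; exists z => //.
  by rewrite -!scalemxAl -!scalemxAr E !scalerA; congr (_ *: _); ring.
have AnB : A ^+ n *m B = B *m A ^+ n.
  have [z zn E] := AB; rewrite -[RHS]scale1r -zn {zn}.
  elim: (n) => [|m IH]; first by rewrite expr0 mulmx1 mul1mx scale1r.
  rewrite {1}exprSr -mulmxE -mulmxA E -scalemxAr mulmxA IH -scalemxAl scalerA -exprS.
  by rewrite -mulmxA mulmxE -exprSr.
(* As [f] is multiplicative only on the group, membership is carried through the induction. Keeping
   the factor [B] lets it start at [f B] instead of [f 1%:M]. *)
have fAB m : MCC_group V (A ^+ m *m B) /\ f (A ^+ m *m B) = f A ^+ m *m f B.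
  elim: m => [|m [IG If]]; first by rewrite !mul1mx; split=> //; exact: VG.
  rewrite !exprS -!mulmxE -!mulmxA -If -fM //; last exact: VG.
  by split=> //; apply: GM => //; exact: VG.
have fBA m : MCC_group V (B *m A ^+ m) /\ f (B *m A ^+ m) = f B *m f A ^+ m.
  elim: m => [|m [IG If]]; first by rewrite !mulmx1; split=> //; exact: VG.
  rewrite !exprSr -!mulmxE !mulmxA -If -fM //; last exact: VG.
  by split=> //; apply: GM => //; exact: VG.
have := (fAB n).2; rewrite AnB (fBA n).2 fA fB exprmxZ alpha_opX muln1 => E.
have k0D : ord0 != ord_max :> 'I_D.+1 by rewrite -val_eqE /= neq_ltn (ltnW D1).
case: (alpha_op_not_comm k0D nD).
move: (alpha_op psi ord0 n) (alpha_op psi ord_max 1) (x ^+ n) (expf_neq0 n x0) E.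
move=> P Q a a0 E; apply: (scalerI y0); apply: (scalerI a0).
by rewrite scalemxAr scalemxAl -E -scalemxAl -scalemxAr !scalerA mulrC.
Qed.

End NonIsomorphism.

(** * Generalized Pauli operators *)

Section Tensor.
Variables (R : realType) (d : nat).
Local Notation C := R[i]%C.

Lemma castmx_square_mul m n (e : m = n) (A B : 'M[C]_m) :
  castmx (e, e) A *m castmx (e, e) B = castmx (e, e) (A *m B).
Proof. by case: n / e; rewrite !castmx_id. Qed.

Lemma castmx_square_adj m n (e : m = n) (A : 'M[C]_m) :
  (castmx (e, e) A)^t* = castmx (e, e) (A^t*).
Proof. by case: n / e; rewrite !castmx_id. Qed.

Lemma castmx_square1 m n (e : m = n) : castmx (e, e) 1%:M = 1%:M :> 'M[C]_n.
Proof. by case: n / e; rewrite castmx_id. Qed.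

Lemma castmx_squareZ m n (e : m = n) (a : C) (A : 'M[C]_m) :
  castmx (e, e) (a *: A) = a *: castmx (e, e) A.
Proof. by case: n / e; rewrite !castmx_id. Qed.

Lemma tensmx11 m n : tensmx 1%:M 1%:M = 1%:M :> 'M[C]_(m * n).
Proof.
apply/matrixP => i j; case: (mxtens_indexP i) => i1 i2; case: (mxtens_indexP j) => j1 j2.
by rewrite tensmxE !mxE (can_eq (@mxtens_indexK _ _)) xpair_eqE -natrM mulnb.
Qed.

Lemma tensmxZ m n (a b : C) (A : 'M[C]_m) (B : 'M[C]_n) :
  tensmx (a *: A) (b *: B) = (a * b) *: tensmx A B.
Proof. by apply/matrixP => i j; rewrite !mxE mulrACA. Qed.

Lemma tensor_mul N (A B : 'I_N -> 'M[C]_d) :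
  tensor A *m tensor B = tensor (fun i => A i *m B i).
Proof.
elim: N A B => [|N IH] A B /=; first by rewrite mulmx1.
by rewrite castmx_square_mul tensmx_mul IH.
Qed.

Lemma tensor_adj N (A : 'I_N -> 'M[C]_d) :
  (tensor A)^t* = tensor (fun i => (A i)^t*).
Proof.
elim: N A => [|N IH] A /=; first by rewrite adjmx1.
by rewrite castmx_square_adj trmx_tens map_mxT IH.
Qed.

Lemma tensor1 N : tensor (fun=> 1%:M) = 1%:M :> 'M[C]_(d ^ N).
Proof.
elim: N => [//|N IH] /=.
by rewrite IH tensmx11 castmx_square1.
Qed.

Lemma tensorZ N (a : 'I_N -> C) (A : 'I_N -> 'M[C]_d) :
  tensor (fun i => a i *: A i) = (\prod_i a i) *: tensor A.
Proof.
elim: N a A => [|N IH] a A /=; first by rewrite big_ord0 scale1r.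
by rewrite IH tensmxZ castmx_squareZ big_ord_recl.
Qed.

End Tensor.

(** * Commutation of the shift and clock matrices *)

Section Weyl.
Variables (R : realType) (d : nat).
Hypothesis d0 : (0 < d)%N.
Local Notation C := R[i]%C.
Local Notation w := (root_unity R d).
Local Notation X := (pauliX R d).
Local Notation Z := (pauliZ R d).

Let wP : d.-primitive_root w := root_unity_prim R d0.

Lemma pauliX_unitary : X \is unitarymx.
Proof.
(* The adjoint is put on the left because column [r] of [X] has its single 1 in the explicit row
   [r.+1 %% d]. *)
apply/unitarymxP/mulmx1C/matrixP => r s; rewrite !mxE.
have lt : (r.+1 %% d < d)%N by rewrite ltn_mod.
rewrite (bigD1 (Ordinal lt)) //= big1 => [|t].
  rewrite !mxE /= eqxx rmorph1 mul1r addr0 -[r.+1]addn1 -[s.+1]addn1 eqn_modDr !modn_small //.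
by rewrite !mxE -val_eqE /= => /negPf ->; rewrite rmorph0 mul0r.
Qed.

Lemma pauliZ_unitary : Z \is unitarymx.
Proof.
apply/unitarymxP/matrixP => r s; rewrite !mxE.
rewrite (bigD1 r) //= big1 => [|t /negPf tr].
  rewrite !mxE eqxx mul1r addr0 rmorphM rmorph_nat.
  have [_|_] := eqVneq s r; last by rewrite mul0r mulr0.
  by rewrite mul1r /= rmorphXn -exprMn expi_conjM expr1n.
by rewrite !mxE eq_sym tr !mul0r.
Qed.

Lemma pauliZX : Z *m X = w *: (X *m Z).
Proof.
apply/matrixP => r s; rewrite !mxE (bigD1 r) //= big1 ?addr0 => [|t /negPf tr]; last first.
  by rewrite !mxE eq_sym tr !mul0r.
rewrite (bigD1 s) //= big1 ?addr0 => [|t /negPf ts]; last first.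
  by rewrite !mxE ts mul0r mulr0.
rewrite !mxE !eqxx !mul1r; case: eqP => [->|_]; last by rewrite mulr0 mul0r mulr0.
by rewrite mulr1 mul1r -exprS prim_expr_mod.
Qed.

Lemma pauliZX_expr a b : Z ^+ b *m X ^+ a = w ^+ (b * a) *: (X ^+ a *m Z ^+ b).
Proof.
have ZbX : Z ^+ b *m X = w ^+ b *: (X *m Z ^+ b).
  elim: b => [|b IH]; first by rewrite mul1mx mulmx1 scale1r.
  rewrite (_ : Z ^+ b.+1 = Z ^+ b *m Z); last exact: exprSr.
  by rewrite -mulmxA pauliZX -scalemxAr (mulmxA (Z ^+ b)) IH -scalemxAl scalerA -exprS -mulmxA.
elim: a => [|a IH]; first by rewrite muln0 mul1mx mulmx1 scale1r.
rewrite (_ : X ^+ a.+1 = X ^+ a *m X); last exact: exprSr.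
rewrite (mulmxA (Z ^+ b)) IH -scalemxAl -mulmxA ZbX -scalemxAr scalerA.
by rewrite -exprD mulnSr mulmxA.
Qed.

Lemma weyl_mul a b a' b' : (X ^+ a *m Z ^+ b) *m (X ^+ a' *m Z ^+ b') =
  w ^+ (b * a') *: (X ^+ (a + a') *m Z ^+ (b + b')).
Proof.
rewrite mulmxA -(mulmxA (X ^+ a)) pauliZX_expr -scalemxAr -scalemxAl; congr (_ *: _).
by rewrite !exprD -!mulmxE !mulmxA.
Qed.

End Weyl.

(** * Pauli operators, their commutation and their vectors over the prime field *)

Section Pauli.
Variables (R : realType) (d N : nat).
Hypothesis d_pr : prime d.
Local Notation C := R[i]%C.
Local Notation w := (root_unity R d).
Local Notation index := ({ffun 'I_N -> 'I_d} * {ffun 'I_N -> 'I_d})%type.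
Local Notation pauli_op x := (pauli R x.1 x.2).

Let d0 : (0 < d)%N := prime_gt0 d_pr.
Let wP : d.-primitive_root w := root_unity_prim R d0.
Let w0 : w != 0.
Proof. by rewrite -normr_eq0 norm_expi oner_eq0. Qed.

Implicit Types x y : index.

(** Half of the symplectic form: modulo [d], [weyl_exponent y x] minus [weyl_exponent x y] is the
    form on the vectors of [x] and [y]. *)
Definition weyl_exponent x y : nat := (\sum_i x.2 i * y.1 i)%N.

Lemma pauli_mul_comm x y : pauli_op x *m pauli_op y =
  (w ^+ weyl_exponent x y / w ^+ weyl_exponent y x) *: (pauli_op y *m pauli_op x).
Proof.
(* The tensor product on the right is symmetric in [u] and [v], so the two orders of multiplication
   differ only by their scalars. *)
have pM (u v : index) : pauli_op u *m pauli_op v = w ^+ weyl_exponent u v *: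
    tensor (fun i => pauliX R d ^+ (u.1 i + v.1 i) *m pauliZ R d ^+ (u.2 i + v.2 i)).
  rewrite /pauli tensor_mul /weyl_exponent (big_morph _ (exprD w) (expr0 w)) -tensorZ.
  by congr tensor; apply/funext => i; rewrite weyl_mul.
rewrite !pM scalerA divfK ?expf_neq0 //; congr (_ *: tensor _).
by apply/funext => i; rewrite addnC [(x.2 i + _)%N]addnC.
Qed.

Lemma pauli_unitary x : pauli_op x \is unitarymx.
Proof.
have uX (A : 'M[C]_d) n : A \is unitarymx -> A ^+ n \is unitarymx.
  move=> uA; elim: n => [|n IH]; first by apply/unitarymxP; rewrite adjmx1 mulmx1.
  by rewrite exprS -mulmxE mul_unitarymx.
apply/unitarymxP; rewrite tensor_adj tensor_mul -tensor1; congr tensor.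
apply/funext => i; apply/unitarymxP/mul_unitarymx; apply: uX.
  exact: pauliX_unitary.
exact: pauliZ_unitary.
Qed.

Let i0 : 'I_d := Ordinal d0.
Let i1 : 'I_d := Ordinal (prime_gt1 d_pr).

Definition pauli_idx0 : index := ([ffun=> i0], [ffun=> i0]).

Lemma pauli_op0 : pauli_op pauli_idx0 = 1%:M.
Proof.
by rewrite -tensor1; congr tensor; apply/funext => i; rewrite !ffunE mulmx1.
Qed.

(** The witness is a single [Z] or a single [X] at a position where [x] and [y] differ in the
    exponent of [X] or of [Z]: its commutation scalar reads off that exponent. *)
Lemma weyl_nondegenerate x y : x != y -> exists z,
  w ^+ weyl_exponent z x / w ^+ weyl_exponent x z !=
  w ^+ weyl_exponent z y / w ^+ weyl_exponent y z.
Proof.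
pose delta (i : 'I_N) : {ffun 'I_N -> 'I_d} := [ffun k => if k == i then i1 else i0].
have sum_delta i (F : 'I_N -> nat) :
    (\sum_k delta i k * F k = F i)%N /\ (\sum_k F k * delta i k = F i)%N.
  split; rewrite (bigD1 i) //= big1 ?ffunE ?eqxx /= ?mul1n ?muln1 ?addn0 //.
    by move=> k /negPf ki; rewrite ffunE ki.
  by move=> k /negPf ki; rewrite ffunE ki muln0.
have neqw (i j : 'I_d) : i != j -> w ^+ i != w ^+ j.
  by rewrite (eq_prim_root_expr wP) !modn_small.
case: x y => [a b] [a' b'].
rewrite xpair_eqE negb_and => /orP[] /eqP ne.
  have [i ai] : exists i, a i != a' i.
    apply/existsP; apply: contra_notT ne => /existsPn E.
    by apply/ffunP => i; move/(_ i): E; rewrite negbK => /eqP.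
  exists ([ffun=> i0], delta i); rewrite /weyl_exponent /= !(sum_delta _ _).1.
  by rewrite !big1 => [|k _|k _]; rewrite ?ffunE ?muln0 // !divr1 neqw.
have [i ai] : exists i, b i != b' i.
  apply/existsP; apply: contra_notT ne => /existsPn E.
  by apply/ffunP => i; move/(_ i): E; rewrite negbK => /eqP.
exists (delta i, [ffun=> i0]); rewrite /weyl_exponent /= !(sum_delta _ _).2.
rewrite !big1 => [|k _|k _]; rewrite ?ffunE ?mul0n //.
by rewrite expr0 !div1r (inj_eq invr_inj) neqw.
Qed.

(* Conjugation by [pauli_op z] multiplies [pauli_op x *m (pauli_op y)^t*], hence
   its trace, by a scalar different from 1. *)
Lemma pauli_orthogonal x y : x != y -> op_orthogonal (pauli_op x) (pauli_op y).
Proof.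
move=> /weyl_nondegenerate[z]; rewrite /op_orthogonal.
have := pauli_mul_comm z x; have := pauli_mul_comm z y.
set p := _ / _; set q := _ / _ => zy zx qp.
have p1 : p * p^* = 1.
  rewrite -normCK /p normrM normfV !normrX norm_expi !expr1n invr1 mulr1.
  by rewrite expr1n.
have /unitarymxP uz := pauli_unitary z; have uz' := mulmx1C uz.
set T := \tr _; have : T = q * p^* * T.
  transitivity (\tr ((pauli_op z *m pauli_op x) *m (pauli_op z *m pauli_op y)^t*)).
    by rewrite adjmxM mulmxA mxtrace_mulC !mulmxA uz' mul1mx.
  rewrite zx zy adjmxZ -scalemxAl -scalemxAr !mxtraceZ mulrA adjmxM.
  by rewrite mulmxA -(mulmxA (pauli_op x)) uz mulmx1.
move/eqP; rewrite -subr_eq0 -{1}[T]mul1r -mulrBl mulf_eq0 subr_eq0 => /orP[/eqP E|/eqP //].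
by case/eqP: qp; rewrite -[LHS]mulr1 -p1 mulrCA -E mulr1.
Qed.

Lemma pauli_comm_root x y : exists2 z : C, z ^+ d = 1 &
  pauli_op x *m pauli_op y = z *: (pauli_op y *m pauli_op x).
Proof.
rewrite pauli_mul_comm; eexists; last by [].
by rewrite expr_div_n ![(_ ^+ _) ^+ d]exprAC (prim_expr_order wP) !expr1n divr1.
Qed.

Local Notation vec x := (pauli_vec x.1 x.2).

Lemma natr_Fp_eq m n : (m%:R == n%:R :> 'F_d) = (m == n %[mod d]).
Proof. by rewrite -val_eqE /= !val_Fp_nat. Qed.

Lemma pauli_vec_inj : injective (fun x => vec x).
Proof.
move=> [a b] [a' b'] /(can_inj mxvecK) /matrixP E.
have nat_inj (i j : 'I_d) : i%:R = j%:R :> 'F_d -> i = j.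
  by move/eqP; rewrite natr_Fp_eq !modn_small // => /eqP/val_inj.
congr (_, _); apply/ffunP => i; apply: nat_inj.
  by have := E i ord0; rewrite !mxE.
by have := E i ord_max; rewrite !mxE.
Qed.

Lemma card_pauli_index : #|{: index}| = ((d ^ N) ^ 2)%N.
Proof. by rewrite card_prod card_ffun !card_ord expnS expn1. Qed.

Lemma pauli_vec_bij : bijective (fun x => vec x).
Proof.
apply: inj_card_bij pauli_vec_inj _.
by rewrite card_pauli_index card_mx card_Fp // mul1n expnM.
Qed.

Lemma pauli_vec0 : vec pauli_idx0 = 0.
Proof.
apply/rowP => k; case/mxvec_indexP: k => i j.
by rewrite mxvecE !mxE !ffunE if_same.
Qed.

Lemma pauli_isotropic_comm (W : {vspace 'rV['F_d]_(N * 2)}) x y :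
  totally_isotropic W -> vec x \in W -> vec y \in W ->
  comm_mx (pauli_op x) (pauli_op y).
Proof.
move=> iW xW yW; rewrite /comm_mx pauli_mul_comm.
suff -> : w ^+ weyl_exponent x y = w ^+ weyl_exponent y x.
  by rewrite divff ?scale1r ?expf_neq0.
apply/eqP; rewrite (eq_prim_root_expr wP) -natr_Fp_eq /weyl_exponent !natr_sum.
(* The difference of the exponents is the symplectic form up to sign. *)
rewrite -subr_eq0 -sumrB -oppr_eq0 -sumrN; apply/eqP; rewrite -[RHS](iW _ _ xW yW).
apply: eq_bigr => i _; rewrite !mxvecE !mxE /= !natrM.
ring.
Qed.

End Pauli.

(** * Spreads *)

Section Spread.
Variables (d N : nat) (S : set {vspace 'rV['F_d]_(N * 2)}).
Hypotheses (d_pr : prime d) (N0 : (0 < N)%N) (S_spread : is_spread S).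
Local Notation vec := 'rV['F_d]_(N * 2).

Let dN1 : (1 < d ^ N)%N.
Proof. by rewrite -(exp1n N) ltn_exp2r ?prime_gt1. Qed.

Lemma spread_card_mem W : S W -> #|[set v : vec | v \in W]%SET| = (d ^ N)%N.
Proof.
by case: S_spread => + _ => /[apply] -[_ dW]; rewrite cardsE card_vspace dW card_Fp.
Qed.

Lemma spread_ex (v : vec) : v != 0 -> exists2 W, S W & v \in W.
Proof.
move=> v0; have [_ /(_ <[v]>%VS)] := S_spread.
by rewrite dim_vline v0 => /(_ erefl)[W [[SW vW] _]]; exists W; rewrite // memvE.
Qed.

Lemma spread_uniq (v : vec) W W' : v != 0 -> S W -> S W' -> v \in W -> v \in W' -> W = W'.
Proof.
move=> v0 SW SW' vW vW'; have [_ /(_ <[v]>%VS)] := S_spread.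
rewrite dim_vline v0 => /(_ erefl)[W'' [_ U]].
by rewrite -(U W) ?(U W') // -memvE.
Qed.

(** The [n] members of the spread partition the [d ^ (2 * N) - 1] nonzero vectors into sets of size
    [d ^ N - 1]. *)
Lemma card_spread : S #= `I_(d ^ N).+1.
Proof.
(* A subspace is determined by its finite set of vectors. *)
have : finite_set S.
  pose h (W : {vspace vec}) := [set v : vec | v \in W]%SET.
  have hinj : {in S &, injective h}.
    by move=> W W' _ _ /setP E; apply/vspaceP => v; have := E v; rewrite !inE.
  by rewrite -(eq_finite_set (inj_card_eq hinj)); exact: finite_finset.
move=> /finite_setP[n Sn]; have [W Winj WS] := card_enum Sn.
have SW k : S (W k) by rewrite -WS; exists k.
suff -> : (d ^ N).+1 = n by [].
pose D := [set v : vec | v != 0]%SET.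
have cD : #|D| = ((d ^ N) ^ 2 - 1)%N.
  have -> : D = [set~ 0]%SET by apply/setP => v; rewrite !inE.
  by rewrite cardsC1 card_mx card_Fp // mul1n expnM subn1.
have cW k : #|[set v in D | v \in W k]%SET| = (d ^ N - 1)%N.
  rewrite -(spread_card_mem (SW k)) [in RHS](cardsD1 (0 : vec)) inE mem0v add1n subn1 /=.
  by apply: eq_card => v; rewrite !inE.
have : (#|D| = n * (d ^ N - 1))%N.
  (* Double counting of the pairs of a nonzero vector and a member containing it. *)
  rewrite -sum1_card.
  transitivity (\sum_(v in D) \sum_(k < n) (v \in W k : nat))%N.
    apply: eq_bigr => v; rewrite inE => v0.
    have [W' + vW'] := spread_ex v0; rewrite -WS => -[k _ Wk].
    rewrite (bigD1 k) //= Wk vW' big1 // => l /eqP lk.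
    apply/eqP; rewrite eqb0; apply/negP => vWl; apply: lk.
    by apply: Winj; apply: (spread_uniq v0) => //; rewrite Wk.
  rewrite exchange_big /=; transitivity (\sum_(k < n) (d ^ N - 1))%N.
    apply: eq_bigr => k _; rewrite -(cW k) -sum1_card.
    rewrite [RHS](eq_bigl (fun v => (v \in D) && (v \in W k))).
      rewrite big_mkcondr; apply: eq_bigr => v _.
      by case: (v \in W k).
    by move=> v; rewrite !inE.
  by rewrite sum_nat_const card_ord.
rewrite cD; nia.
Qed.

End Spread.

(** * The MCC of Pauli operators attached to a spread *)

Section PauliMCC.
Variables (R : realType) (d N : nat) (S : set {vspace 'rV['F_d]_(N * 2)}).
Hypotheses (d_pr : prime d) (N0 : (0 < N)%N) (S_spread : is_spread S).
Local Notation index := ({ffun 'I_N -> 'I_d} * {ffun 'I_N -> 'I_d})%type.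
Local Notation pauli_op x := (pauli R x.1 x.2).
Local Notation vec x := (pauli_vec x.1 x.2).

Lemma pauli_inj : injective (fun x : index => pauli_op x).
Proof.
move=> x y /= E; apply: contrapT => /eqP /(pauli_orthogonal R d_pr).
rewrite /op_orthogonal -E (unitarymxP (pauli_unitary R d_pr x)) mxtrace1 => /eqP.
by rewrite pnatr_eq0 expn_eq0 -leqn0 leqNgt prime_gt0.
Qed.

Lemma pauli_MCC_is_MCC : is_MCC (pauli_MCC R S).
Proof.
have [W Winj WS] := card_enum (card_spread d_pr N0 S_spread).
have SW k : S (W k) by rewrite -WS; exists k.
pose x0 := pauli_idx0 N d_pr.
have v0 (x : index) : (vec x == 0) = (x == x0).
  by rewrite -(pauli_vec0 N d_pr) (inj_eq (@pauli_vec_inj d N d_pr)).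
pose cl k := [set x : index | (x != x0) && (vec x \in W k)]%SET.
have clE k : @pauli_class R d N (W k) = [set pauli_op x | x in [set` cl k]].
  apply/seteqP; split=> [s [s1 [a [b [sE abW]]]]|_ [x + <-]].
    (* Indices are finite functions, to form a finite type, whereas [pauli_class] quantifies over
       plain functions. *)
    rewrite sE in s1 *; exists (finfun a, finfun b).
      rewrite /= inE; apply/andP; split.
        apply/eqP => E; apply: s1; rewrite -(pauli_op0 R N d_pr) -/x0 -E /=.
        by congr pauli; apply/funext => i; rewrite ffunE.
      rewrite memvE /=; apply: etrans abW; congr (<[pauli_vec _ _]> <= _)%VS.
        by apply/funext => i; rewrite ffunE.
      by apply/funext => i; rewrite ffunE.
    by rewrite /=; congr pauli; apply/funext => i; rewrite ffunE.
  rewrite /= inE => /andP[xx0 xW]; split.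
    by move=> E; move/eqP: xx0; apply; apply: pauli_inj; rewrite E pauli_op0.
  by exists x.1, x.2; rewrite -memvE.
have -> : pauli_MCC R S = [set [set pauli_op x | x in [set` cl k]] | k in [set: 'I_(d ^ N).+1]].
  rewrite /pauli_MCC -WS; apply/seteqP; split=> [_ [_ [k _ <-] <-]|_ [k _ <-]].
    by exists k => //; rewrite clE.
  by exists (W k); [exists k|rewrite clE].
apply: (@is_MCC_family _ _ _ _ x0 cl).
- by rewrite -(exp1n N) ltn_exp2r ?prime_gt1.
- exact: card_pauli_index.
- exact: pauli_op0.
- exact: pauli_unitary.
- exact: pauli_orthogonal.
- by move=> k; rewrite inE eqxx.
(* Pulling [W k] back along the bijection with vectors gives [d ^ N] indices; removing that of the
   identity, the preimage of 0, leaves [d ^ N - 1]. *)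
- move=> k; have [g gK Kg] := @pauli_vec_bij d N d_pr.
  have -> : cl k = ((fun x : index => vec x) @^-1: ([set v | v \in W k]%SET) :\ x0)%SET.
    by apply/setP => x; rewrite !inE.
  have /eqP := cardsD1 x0 ((fun x : index => vec x) @^-1: [set v | v \in W k]%SET).
  rewrite !inE pauli_vec0 mem0v add1n on_card_preimset ?(spread_card_mem d_pr S_spread) //.
    by move/eqP => ->.
  by exists g => x _; [exact: gK|exact: Kg].
- move=> x k l; rewrite !inE => /andP[xx0 xk] /andP[_ xl]; apply: Winj.
  by apply: (spread_uniq S_spread _ (SW k) (SW l) xk xl); rewrite v0.
- move=> k x y; rewrite !inE => /andP[_ xk] /andP[_ yk].
  have [/(_ _ (SW k))[iW _] _] := S_spread.
  exact: pauli_isotropic_comm iW xk yk.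
Qed.

Lemma pauli_MCC_operators (A : 'M[R[i]%C]_(d ^ N)) : operators (pauli_MCC R S) A ->
  exists x : index, A = pauli_op x.
Proof.
move=> [_ [W _ <-] [_ [a [b [-> _]]]]]; exists (finfun a, finfun b).
by congr pauli; apply/funext => i; rewrite ffunE.
Qed.

End PauliMCC.

Theorem mainTheorem1 (R : realType) (d N : nat)
    (S : set {vspace 'rV['F_d]_(N * 2)}) :
  prime d -> (1 < N)%N -> is_spread S ->
  let U_S := pauli_MCC R S in
  let B_S := beta U_S in
  [/\ is_maxMUB B_S,
      beta_preimage B_S U_S,
      forall psi : 'I_(d ^ N).+1 -> 'I_(d ^ N) -> 'cV[R[i]%C]_(d ^ N),
        is_listing B_S psi ->
        beta_preimage B_S (alpha psi) /\ ~ MCC_isomorphic U_S (alpha psi),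
      ~ set_inj [set U : set (set 'M[R[i]%C]_(d ^ N)) | is_MCC U]%classic
          (@beta R (d ^ N))
    & exists U U' : set (set 'M[R[i]%C]_(d ^ N)),
        [/\ is_MCC U, is_MCC U', beta U = beta U' & ~ MCC_isomorphic U U']].
Proof.
move=> d_pr N1 SS U_S B_S; have N0 := ltnW N1.
have D1 : (1 < d ^ N)%N by rewrite -(exp1n N) ltn_exp2r ?prime_gt1.
(* Here [N > 1] enters: the [d]-th power of [U^k_1] is not scalar because [d] is smaller than the
   dimension. *)
have dD : (0 < d < d ^ N)%N.
  by rewrite prime_gt0 // -[X in (X < _)%N]expn1 ltn_exp2l // prime_gt1.
have mU : is_MCC U_S := pauli_MCC_is_MCC R d_pr N0 SS.
have mB : is_maxMUB B_S := beta_maxMUB D1 mU.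
have alphaP psi : is_listing B_S psi ->
    beta_preimage B_S (alpha psi) /\ ~ MCC_isomorphic U_S (alpha psi).
  move=> lB; split; first exact: alpha_beta_preimage.
  apply: (not_isomorphic_alpha D1 lB.1 (listing_unbiased mB lB) dD).
  move=> A B /pauli_MCC_operators[x ->] /pauli_MCC_operators[y ->].
  exact: pauli_comm_root.
have [psi lpsi] := maxMUB_listing mB.
have [[mA bA] nA] := alphaP psi lpsi.
have bE : beta U_S = beta (alpha psi) by rewrite bA.
split=> //; last by exists U_S, (alpha psi).
(* Injectivity would identify the two MCCs, and then the identity map, with trivial scaling, would
   be an isomorphism. *)
move=> binj; apply: nA.
have <- : U_S = alpha psi by apply: binj; rewrite ?inE.
have sE : scale_MCC (fun=> 1) U_S = U_S.
  have sK (K : set 'M[R[i]%C]_(d ^ N)) : [set 1 *: A | A in K] = K.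
    by rewrite (_ : (fun A => 1 *: A) = id) ?image_id //; apply/funext => A; exact: scale1r.
  apply/seteqP; split=> [_ [K UK <-]|K UK]; first by rewrite sK.
  by exists K => //; rewrite sK.
exists (fun=> 1), (fun=> 1); split; rewrite ?normr1 //.
exists id; rewrite sE; split=> //; last exact: image_id.
by split=> [//|A B _ _ //|A GA]; exists A.
Qed.
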